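(* Let $M$ be a smooth compact $d$-dimensional Riemannian manifold embedded in $\mathbb{R}^D$ (with the induced metric), $D>d$. Fix $x\in M$ and let $S_x(c,r)$ be a $d$-dimensional sphere through $x$ with center $c$ and radius $r$ whose tangent space at $x$ is also $T_xM$, with associated spherical distance $d_S$ (defined in the context). For $y=\exp_x(sv)$, $v$ a unit vector in $T_xM$, such that $d_M(x,y)=s$, $$d_S(x,y)=s+O(s^3)\qquad(s\to0).$$
   Context: $d_M$ is the geodesic distance on $M$ and $\exp_x$ the Riemannian exponential map. A $d$-dimensional sphere through $x$ with tangent space $T_xM$ at $x$ is the set of points at distance $r$ from $c$ inside the $(d+1)$-dimensional affine space $x+V$, where $c=x+r\mathbf{n}$ for a unit vector $\mathbf{n}\in (T_xM)^\perp$ and $V=T_xM\oplus\mathrm{span}(\mathbf{n})$. The projection $\pi$ from the manifold to the sphere is $\pi(z)=c+r\,\frac{P_V(z-c)}{\|P_V(z-c)\|}$, where $P_V$ is the orthogonal projection of $\mathbb{R}^D$ onto $V$ (defined when $P_V(z-c)\ne0$, in particular near $x$). The spherical distance is $$d_S(x,y)=r\arccos\left\{\frac{\pi(x)-c}{r}\cdot\frac{\pi(y)-c}{r}\right\},$$ i.e. the geodesic distance on the sphere between $\pi(x)=x$ and $\pi(y)$. *)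

(* Defs.v *)
(* Points of R^D are row vectors.  The library's norm on
   matrices is the sup norm: it gives the usual topology and the usual notion
   of derivative, but lengths and angles go through [dot] and [enorm]. *)
From HB Require Import structures.
From mathcomp Require Import all_boot all_order all_algebra.
From mathcomp Require Import all_classical all_reals all_analysis.
Set Implicit Arguments.
Unset Strict Implicit.
Unset Printing Implicit Defensive.
Import Order.TTheory GRing.Theory Num.Theory.
Import numFieldNormedType.Exports.
Local Open Scope ring_scope.
Local Open Scope classical_set_scope.

Section Smooth.
Context {R : realType} {V W : normedModType R}.

Fixpoint Ck_on (k : nat) (A : set V) (f : V -> W) : Prop :=
  if k is k'.+1 then
    (forall x, A x -> differentiable f x) /\ (forall v, Ck_on k' A ('D_v f))
  else forall x, A x -> {for x, continuous f}.

(* Meaningful for open [A] only: the derivatives at points of [A] see [f] on a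
   whole neighbourhood. *)
Definition smooth_on (A : set V) (f : V -> W) := forall k, Ck_on k A f.
End Smooth.

Section Euclidean.
Context {R : realType} {D : nat}.
Implicit Types (u v w z c : 'rV[R]_D) (V : set 'rV[R]_D).

Definition dot u v : R := \sum_(i < D) u 0 i * v 0 i.

Definition enorm u : R := Num.sqrt (dot u u).

Definition orthogonal_to V w := forall u, V u -> dot w u = 0.

(* For a linear subspace [V] the point below exists and is unique. *)
Definition orth_proj V w : 'rV[R]_D :=
  xget 0 [set p | V p /\ orthogonal_to V (w - p)].

(* When [V] is linear and P_V (z - c) = 0, the inverse is 0 and the value is the
   junk value [c]. *)
Definition sphere_proj V c (r : R) z : 'rV[R]_D :=
  c + (r / enorm (orth_proj V (z - c))) *: orth_proj V (z - c).

Definition sphere_dist V c (r : R) x y : R :=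
  r * acos (dot (r^-1 *: (sphere_proj V c r x - c))
                (r^-1 *: (sphere_proj V c r y - c))).
End Euclidean.

Section Submanifold.
Context {R : realType} {D : nat}.
Implicit Types (M : set 'rV[R]_D) (x y p v w : 'rV[R]_D).

(* Each point has an ambient chart (a diffeomorphism [Phi] of an open set [U]
   onto an open set, with inverse [Psi]) flattening M onto R^d x {0}. *)
Definition embedded_submanifold (d : nat) M :=
  forall p, M p ->
  exists (U : set 'rV[R]_D) (Phi Psi : 'rV[R]_D -> 'rV[R]_D),
    [/\ open U, U p & open (Phi @` U)] /\
    [/\ smooth_on U Phi, smooth_on (Phi @` U) Psi,
        (forall z, U z -> Psi (Phi z) = z) &
        (forall z, U z -> M z <-> forall i : 'I_D, (d <= i)%N -> Phi z 0 i = 0)].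

Definition smooth_curve M (I : set R) (g : R -> 'rV[R]_D) :=
  [/\ open I, smooth_on I g & forall t, I t -> M (g t)].

Definition tangent_space M p : set 'rV[R]_D :=
  [set v | exists (I : set R) (g : R -> 'rV[R]_D),
     [/\ smooth_curve M I g, I 0, g 0 = p & g^`() 0 = v]].

(* For the induced metric, the covariant derivative along [g] of its velocity is
   the tangential part of the ambient acceleration. *)
Definition geodesic M (I : set R) (g : R -> 'rV[R]_D) :=
  [/\ is_interval I, smooth_curve M I g &
      forall t, I t -> orthogonal_to (tangent_space M (g t)) (g^`(2)%classic t)].

(* exp_x(w) = g(1) for the geodesic [g] with g(0) = x, g'(0) = w.  For [M]
   compact and [w] tangent at [x], such a geodesic exists and g(1) is unique,
   so the default value [x] is not used. *)
Definition exp_map M x w : 'rV[R]_D :=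
  xget x [set y | exists (I : set R) (g : R -> 'rV[R]_D),
     [/\ geodesic M I g, I 0 & I 1] /\
     [/\ g 0 = x, g^`() 0 = w & g 1 = y]].

(* Piecewise smooth paths in [M] with their length.  Smoothness of a piece on
   the closed interval [a, b] means that it extends to a smooth map on R. *)
Inductive path_of_length M : 'rV[R]_D -> 'rV[R]_D -> \bar R -> Prop :=
| path_nil x : M x -> path_of_length M x x 0%E
| path_cons (g : R -> 'rV[R]_D) (a b : R) y l :
    a <= b -> smooth_on setT g -> (forall t, a <= t <= b -> M (g t)) ->
    path_of_length M (g b) y l ->
    path_of_length M (g a) y
      (\int[lebesgue_measure]_(t in `[a, b]) (enorm (g^`()%classic t))%:E + l)%E.

(* Equal to +oo for points in different connected components. *)
Definition geodesic_dist M x y : \bar R :=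
  ereal_inf [set l | path_of_length M x y l].

(* The direct sum T_xM (+) span(n). *)
Definition tangent_plus_line M x (n : 'rV[R]_D) : set 'rV[R]_D :=
  [set u | exists v (a : R), tangent_space M x v /\ u = v + a *: n].
End Submanifold.

(* Main.v *)
Require Import Defs.
From HB Require Import structures.
From mathcomp Require Import all_boot all_order all_algebra.
From mathcomp Require Import all_classical all_reals all_analysis.
From mathcomp Require Import ring lra.
Import Order.TTheory GRing.Theory Num.Theory.
Import numFieldNormedType.Exports.
Local Open Scope ring_scope.
Local Open Scope classical_set_scope.

(** Let [g] be a geodesic with [g 0 = x], [g' 0 = s v] and [g 1 = y].  On the
    sphere, the angle at [c] between [x] and [pi y] has tangent [|q| / b],
    where [q] is the orthogonal projection of [y - x] on the tangent space [T]
    of [M] at [x] and [b = r - <y - x, n>].  As [atan t = t + O(t^3)], the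
    theorem follows from [|q|^2 = s^2 + O(s^4)] and [b = r + O(s^2)], both
    uniform in [v].

    These two estimates come from Taylor expansion of [<g t - x, u>] at order
    two, for a fixed vector [u].  The error is controlled by [<g'' t, u>], which
    is [O(s^2)] for every [u] because [g] has speed [s] and bounded curvature,
    and [O(s^3)] when [u] is in [T], because [g'' t] is orthogonal to the
    tangent space at [g t], which is at distance [O(s)] from [T]
    ([geodesic_expansion]).

    The geometry of [M] enters through one object: a family of matrices [Q p],
    Lipschitz near [x], such that [Q p] is an oblique projector on the tangent
    space at [p] ([tangent_projector]).  In a chart it is the differential of
    the chart followed by the coordinate projection on [R^d] and by the
    differential of the inverse chart.  The identity [g' = g' Q(g)] and the
    orthogonality of [g''] to the range of [Q(g)] bound [|g''|] by a multiple of
    [K s^2], with [K] the Lipschitz constant of [Q].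

    The geodesic [g] is provided by the hypothesis on the distance: if none had
    initial velocity [s v] then the exponential map would take its default value
    [x], which is not at distance [s > 0] from [x] ([exp_map_geodesic]). *)

(** * Functions along affine lines *)

Section AffineReparametrization.
Context {R : realType} {V W : normedModType R}.
Implicit Types (q a : V) (f : V -> W).

Lemma differentiable_affine q a (t : R) :
  differentiable (fun t : R => q + t *: a) t.
Proof. exact: differentiableD. Qed.

(** The two difference quotients coincide, so that the equality holds at every
    point, differentiability or not.  This is what makes the induction on the
    order of smoothness below immediate. *)
Lemma derive_comp_affine q a f (v : R) :
  'D_v (fun t : R => f (q + t *: a)) = fun t => 'D_(v *: a) f (q + t *: a).
Proof.
apply/funext => t; rewrite /derive.
set F := (X in lim (X @ _)); set G := (X in _ = lim (X @ _)).
suff -> : F = G by []; apply/funext => h; rewrite /F /G /=.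
by rewrite scalerDl scalerA [_ *: v](mulrC h) mulrC addrCA.
Qed.

Lemma is_derive_comp_affine q a f (t : R) : differentiable f (q + t *: a) ->
  is_derive t 1 (fun t : R => f (q + t *: a)) ('D_a f (q + t *: a)).
Proof.
move=> df; apply: DeriveDef.
  apply/derivable1_diffP.
  apply: (@differentiable_comp _ _ _ _ (fun t : R => q + t *: a) f) df.
  exact: differentiable_affine.
have := congr1 (fun h => h t) (derive_comp_affine q a f 1).
by rewrite scale1r.
Qed.

Lemma Ck_on_comp_affine k (B : set V) q a f : Ck_on k B f ->
  Ck_on k [set t : R | B (q + t *: a)] (fun t => f (q + t *: a)).
Proof.
elim: k f => [|k IHk] f /=.
  move=> fB t Bt; apply: (@continuous_comp _ _ _ (fun t : R => q + t *: a) f).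
    exact/differentiable_continuous/differentiable_affine.
  exact: fB.
move=> [df Df]; split=> [t Bt|v]; last first.
  by rewrite derive_comp_affine; exact: (IHk _ (Df (v *: a))).
apply: (@differentiable_comp _ _ _ _ (fun t : R => q + t *: a) f).
  exact: differentiable_affine.
exact: df.
Qed.

Lemma open_affine_preimage (B : set V) q a : open B ->
  open [set t : R | B (q + t *: a)].
Proof.
move=> oB; apply: (@open_comp _ _ (fun t : R => q + t *: a)) oB => t _.
exact/differentiable_continuous/differentiable_affine.
Qed.

End AffineReparametrization.

(** * Local Lipschitz continuity of smooth maps *)

Section SupNorm.
Context {R : realType}.

Lemma mx_entry_le_norm m n (A : 'M[R]_(m, n)) i j : `|A i j| <= `|A|.
Proof.
rewrite [leRHS]/Num.Def.normr/= mx_normrE.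
exact: (le_bigmax _ (fun k : 'I_m * 'I_n => `|A k.1 k.2|) (i, j)).
Qed.

Lemma mx_norm_le m n (A : 'M[R]_(m, n)) b : 0 <= b ->
  (forall i j, `|A i j| <= b) -> `|A| <= b.
Proof.
by move=> b0 Ab; rewrite [leLHS]/Num.Def.normr/= mx_normrE bigmax_le.
Qed.

Lemma ler_norm_mulmx m n p (A : 'M[R]_(m, n)) (B : 'M[R]_(n, p)) :
  `|A *m B| <= n%:R * (`|A| * `|B|).
Proof.
apply: mx_norm_le => [|i j]; first by rewrite !mulr_ge0.
rewrite mxE (le_trans (ler_norm_sum _ _ _))//.
rewrite mulr_natl -[X in _ *+ X]card_ord -sumr_const ler_sum// => k _.
by rewrite normrM ler_pM// mx_entry_le_norm.
Qed.

End SupNorm.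

(** One constant for all pairs of points of a neighbourhood, and not only for
    pairs [(y, p)]: the curvature bound compares two neighbouring points
    of a geodesic, at an arbitrary time. *)
Definition lipschitz_near {R : realType} {V W : normedModType R}
    (f : V -> W) (p : V) :=
  exists2 K : R, 0 <= K & exists2 A, nbhs p A &
    forall y z, A y -> A z -> `|f y - f z| <= K * `|y - z|.

Lemma MVT_closed {R : realType} (f df : R -> R) (a b : R) : a <= b ->
  (forall t : R, a <= t <= b -> is_derive t 1 f (df t)) ->
  exists2 t, a <= t <= b & f b - f a = df t * (b - a).
Proof.
move=> ab fdf.
have [t tab|t tab|t tab ->] := @MVT_segment _ f df a b ab.
- by apply: fdf; rewrite !ltW ?(itvP tab).
- apply: derivable_within_continuous => u uab.
  by have [] := fdf u; rewrite ?(itvP uab).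
- by exists t => //; rewrite !(itvP tab).
Qed.

Section LipschitzNear.
Context {R : realType}.

Lemma lipschitz_near_continuous (V W : normedModType R) (f : V -> W) p :
  lipschitz_near f p -> {for p, continuous f}.
Proof.
move=> [K K0 [A pA fA]]; apply/cvgrPdist_le => e e0; near=> y.
rewrite (le_trans (fA _ _ (nbhs_singleton pA) _))//; first by near: y.
apply: (@le_trans _ _ ((K + 1) * `|p - y|)); first by rewrite ler_wpM2r// lerDl.
rewrite -ler_pdivlMl ?ltr_wpDl//; near: y.
by apply: cvgr_dist_le; [exact: cvg_id|rewrite mulr_gt0// invr_gt0 ltr_wpDl].
Unshelve. all: by end_near. Qed.

Lemma lipschitz_near_comp (U V W : normedModType R) (f : U -> V) (g : V -> W) p :
  lipschitz_near f p -> lipschitz_near g (f p) -> lipschitz_near (g \o f) p.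
Proof.
move=> lf [L L0 [B pB gB]]; have cf := lipschitz_near_continuous _ _ _ _ lf.
case: lf => K K0 [A pA fA].
exists (L * K); first exact: mulr_ge0.
exists (A `&` f @^-1` B); first by apply: filterI => //; exact: cf.
move=> y z [Ay By] [Az Bz]; rewrite (le_trans (gB _ _ By Bz))//.
by rewrite -mulrA ler_wpM2l// fA.
Qed.

Lemma lipschitz_near_cst (V W : normedModType R) (a : W) (p : V) :
  lipschitz_near (fun=> a) p.
Proof.
exists 0 => //; exists setT; first exact: filterT.
by move=> y z _ _; rewrite subrr normr0 mul0r.
Qed.

(** Near [p] both factors are bounded, by continuity, and
    [FG(y) - FG(z) = (F y - F z) G y + F z (G y - G z)]. *)
Lemma lipschitz_near_mulmx (V : normedModType R) m n k
    (F : V -> 'M[R]_(m, n)) (G : V -> 'M[R]_(n, k)) p :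
  lipschitz_near F p -> lipschitz_near G p ->
  lipschitz_near (fun z => F z *m G z) p.
Proof.
move=> lF lG.
have bounded (W : normedModType R) (f : V -> W) : lipschitz_near f p ->
    \forall y \near p, `|f y| <= `|f p| + 1.
  move=> /lipschitz_near_continuous cf.
  near=> y; rewrite -[f y](subrK (f p)) (le_trans (ler_normD _ _))// addrC lerD2l.
  by rewrite distrC; near: y; apply: cvgr_dist_le.
have bF := bounded _ _ lF; have bG := bounded _ _ lG.
case: lF => K K0 [A pA FA]; case: lG => L L0 [B pB GB].
exists (n%:R * (K * (`|G p| + 1)) + n%:R * ((`|F p| + 1) * L)).
  by rewrite addr_ge0// !mulr_ge0// addr_ge0.
exists (A `&` B `&` ([set y | `|F y| <= `|F p| + 1]
                 `&` [set y | `|G y| <= `|G p| + 1])).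
  by do 2?[apply: filterI => //].
move=> y z [[Ay By] [Fy Gy]] [[Az Bz] [Fz Gz]].
have -> : F y *m G y - F z *m G z = (F y - F z) *m G y + F z *m (G y - G z).
  by rewrite mulmxBl mulmxBr subrKA.
rewrite (le_trans (ler_normD _ _))// mulrDl lerD//.
  rewrite (le_trans (ler_norm_mulmx _ _ _ _ _))// -!mulrA ler_wpM2l//.
  by rewrite [K * _]mulrCA [leRHS]mulrC ler_pM// FA.
rewrite (le_trans (ler_norm_mulmx _ _ _ _ _))// -!mulrA ler_wpM2l//.
by rewrite ler_pM// GB.
Unshelve. all: by end_near. Qed.

Lemma lipschitz_near_row_mx (V : normedModType R) m n
    (F : V -> 'M[R]_(m, n)) p :
  (forall i, lipschitz_near (fun z => row i (F z)) p) -> lipschitz_near F p.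
Proof.
move=> lF.
have /choice[KA KAP] : forall i, exists KA : R * set V, [/\ 0 <= KA.1,
    nbhs p KA.2 & forall y z, KA.2 y -> KA.2 z ->
      `|row i (F y) - row i (F z)| <= KA.1 * `|y - z|].
  by move=> i; have [K K0 [A pA FA]] := lF i; exists (K, A).
have K0 i : 0 <= (KA i).1 by case: (KAP i).
exists (\sum_i (KA i).1); first exact: sumr_ge0.
exists [set y | forall i, (KA i).2 y].
  by apply: filter_forall => i; case: (KAP i).
move=> y z Ay Az; apply: mx_norm_le => [|i j].
  by rewrite mulr_ge0// sumr_ge0.
have [_ _ /(_ y z (Ay i) (Az i)) Fi] := KAP i.
have -> : (F y - F z) i j = (row i (F y) - row i (F z)) 0 j by rewrite !mxE.
rewrite (le_trans (mx_entry_le_norm _ _ _ _ _))// (le_trans Fi)//.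
by rewrite ler_wpM2r// (bigD1 i)//= lerDl sumr_ge0.
Qed.

Lemma derive_coord (V : normedModType R) m n (f : V -> 'M[R]_(m, n)) x v i j :
  derivable f x v -> 'D_v (fun z => f z i j) x = ('D_v f x) i j.
Proof. by move=> /derive_mx ->; rewrite mxE. Qed.

Lemma norm_derive_le m n (f : 'rV[R]_m -> 'rV[R]_n) z v :
  differentiable f z ->
  `|'D_v f z| <= (\sum_i `|'D_(delta_mx 0 i) f z|) * `|v|.
Proof.
move=> df; rewrite deriveE// [v in 'd f z v]row_sum_delta linear_sum.
rewrite (le_trans (ler_norm_sum _ _ _))// mulr_suml ler_sum// => i _.
rewrite linearZ -deriveE//= normrZ mulrC ler_wpM2l//.
exact: mx_entry_le_norm.
Qed.

(** The partial derivatives are continuous, hence bounded on a small ball, which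
    is convex: the mean value theorem applies along the segment joining two
    points of the ball, one coordinate at a time. *)
Lemma C1_lipschitz_near m n (U : set 'rV[R]_m) (f : 'rV[R]_m -> 'rV[R]_n) p :
  open U -> U p -> Ck_on 1 U f -> lipschitz_near f p.
Proof.
move=> oU Up [df Df].
pose K := \sum_i (`|'D_(delta_mx 0 i) f p| + 1).
have K0 : 0 <= K by apply: sumr_ge0 => i _; rewrite addr_ge0.
have : nbhs p [set y | U y /\ \sum_i `|'D_(delta_mx 0 i) f y| <= K].
  have pU : nbhs p U by apply: open_nbhs_nbhs.
  apply: (filterI pU).
  have : \forall y \near p, forall i : 'I_m,
      `|'D_(delta_mx 0 i) f y| <= `|'D_(delta_mx 0 i) f p| + 1.
    have := @filter_forall _ _
      (fun i y => `|'D_(delta_mx 0 i) f y| <= `|'D_(delta_mx 0 i) f p| + 1)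
      (nbhs p) _.
    apply=> i; near=> y.
    rewrite -['D_(_) f y](subrK ('D_(delta_mx 0 i) f p)).
    rewrite (le_trans (ler_normD _ _))// addrC lerD2l distrC.
    by near: y; apply: cvgr_dist_le => //; exact: Df.
  by apply: filterS => y fy; exact: ler_sum.
move=> /nbhs_ballP[e /= e0 eU].
exists K => //; exists (ball p e); first exact: nbhsx_ballx.
move=> y z py pz.
have seg (t : R) : 0 <= t <= 1 -> ball p e (z + t *: (y - z)).
  move: py pz; rewrite -!ball_normE /= => py pz /andP[t0 t1].
  have -> : p - (z + t *: (y - z)) = (1 - t) *: (p - z) + t *: (p - y).
    by apply/matrixP => i j; rewrite !mxE; ring.
  rewrite (le_lt_trans (ler_normD _ _))// !normrZ (ger0_norm t0).
  rewrite ger0_norm ?subr_ge0//.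
  have [->|tn0] := eqVneq t 0; first by rewrite subr0 mul0r addr0 mul1r.
  have -> : e = (1 - t) * e + t * e by ring.
  apply: ler_ltD; last by rewrite ltr_pM2l// lt_def tn0.
  by apply: ler_wpM2l; rewrite ?subr_ge0// ltW.
apply: mx_norm_le => [|i j]; first by rewrite mulr_ge0.
pose g (t : R) := f (z + t *: (y - z)) i j.
have dg (t : R) : 0 <= t <= 1 ->
    is_derive t 1 g (('D_(y - z) f (z + t *: (y - z))) i j).
  move=> /seg /eU[Ut _].
  have [dft <-] := is_derive_comp_affine z (y - z) f t (df _ Ut).
  apply: DeriveDef; first by move/derivable_mxP : dft => /(_ i j).
  exact: (derive_coord _ _ _ (fun t : R => f (z + t *: (y - z)))).
have [t t1 gE] := MVT_closed _ _ _ _ ler01 dg.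
have -> : (f y - f z) i j = g 1 - g 0.
  by rewrite /g !mxE scale1r scale0r addr0 addrCA subrr addr0.
have [Ut Kt] := eU _ (seg _ t1).
rewrite gE subr0 mulr1 (le_trans (mx_entry_le_norm _ _ _ _ _))//.
rewrite (le_trans (norm_derive_le _ _ _ _ _ _))//; first exact: df.
by rewrite ler_wpM2r.
Unshelve. all: by end_near. Qed.

Lemma row_jacobian m n (f : 'rV[R]_m -> 'rV[R]_n) z i :
  differentiable f z -> row i ('J f z) = 'D_(delta_mx 0 i) f z.
Proof. by move=> df; rewrite rowE deriveEjacobian. Qed.

Lemma lipschitz_near_eq (V W : normedModType R) (f g : V -> W) p :
  {near p, f =1 g} -> lipschitz_near f p -> lipschitz_near g p.
Proof.
move=> fg [K K0 [A pA fA]]; exists K => //.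
exists (A `&` [set z | f z = g z]); first exact: filterI.
by move=> y z [Ay /= <-] [Az /= <-]; exact: fA.
Qed.

Lemma C2_lipschitz_near_jacobian m n (U : set 'rV[R]_m)
    (f : 'rV[R]_m -> 'rV[R]_n) p :
  open U -> U p -> Ck_on 2 U f -> lipschitz_near (fun z => 'J f z) p.
Proof.
move=> oU Up [df Df]; apply: lipschitz_near_row_mx => i.
apply: (@lipschitz_near_eq _ _ ('D_(delta_mx 0 i) f)).
  near=> y; rewrite row_jacobian//; apply: df; near: y.
  by apply: open_nbhs_nbhs.
exact: C1_lipschitz_near (Df _).
Unshelve. all: by end_near. Qed.

End LipschitzNear.

(** * Tangent spaces of an embedded submanifold *)

Section TangentSpaces.
Context {R : realType} {D : nat}.
Implicit Types (M U : set 'rV[R]_D) (p w : 'rV[R]_D).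

(** Shifting the parameter of the curve brings the point [g t] to time 0, as the
    definition of the tangent space requires. *)
Lemma velocity_tangent M (I : set R) (g : R -> 'rV[R]_D) (t : R) :
  smooth_curve M I g -> I t -> tangent_space M (g t) (g^`() t).
Proof.
move=> [oI sg gM] It.
have at0 : t + 0 *: (1 : R) = t by rewrite scale0r addr0.
exists [set u | I (t + u *: (1 : R))], (fun u => g (t + u *: (1 : R))).
rewrite /= at0; split=> //.
  split; first exact: open_affine_preimage.
    by move=> k; exact/Ck_on_comp_affine/sg.
  by move=> u Iu; exact: gM.
have [|_ E] := is_derive_comp_affine t (1 : R) g 0.
  by rewrite at0; exact: (sg 1%N).1.
by rewrite derive1E; apply: (eq_trans E); rewrite at0 derive1E.
Qed.

Lemma derive_comp (U V W : normedModType R) (f : U -> V) (g : V -> W) z v :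
  differentiable f z -> differentiable g (f z) ->
  'D_v (g \o f) z = 'D_('D_v f z) g (f z).
Proof.
move=> df dg; rewrite !deriveE//; last exact: differentiable_comp.
by rewrite diff_comp.
Qed.

Lemma mulmx_pid_entry (a : 'rV[R]_D) d j :
  (a *m pid_mx d : 'rV_D) 0 j = a 0 j *+ (j < d)%N.
Proof.
rewrite mxE (bigD1 j)//= big1 ?addr0 => [|k kj].
  by rewrite mxE eqxx /= mulr_natr.
by rewrite mxE val_eqE (negbTE kj) /= mulr0.
Qed.

(** In the chart the tangent space at [p] is [R^d] pulled back by the
    differential of [Phi].  The projector sends [w] to its image under that
    differential, drops the coordinates of index at least [d], and comes back
    with the differential of [Psi]; it is the product of two Jacobian matrices
    and a constant one, whence its Lipschitz continuity. *)
Lemma tangent_projector d M x : embedded_submanifold d M -> M x ->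
  exists2 Q : 'rV[R]_D -> 'M[R]_D, lipschitz_near Q x &
    \forall p \near x, M p ->
      (forall w, tangent_space M p (w *m Q p)) /\
      (forall w, tangent_space M p w -> w *m Q p = w).
Proof.
move=> hM Mx; have [U [Phi [Psi [[oU Ux oPU] [sPhi sPsi PsiK flat]]]]] := hM x Mx.
have dPhi p : U p -> differentiable Phi p by apply: (sPhi 1%N).1.
have PU p : U p -> (Phi @` U) (Phi p) by exists p.
have dPsi q : (Phi @` U) q -> differentiable Psi q by apply: (sPsi 1%N).1.
exists (fun p => 'J Phi p *m pid_mx d *m 'J Psi (Phi p)).
  apply: lipschitz_near_mulmx; first apply: lipschitz_near_mulmx.
  - exact: C2_lipschitz_near_jacobian oU Ux (sPhi 2%N).
  - exact: lipschitz_near_cst.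
  - apply: (@lipschitz_near_comp _ _ _ _ Phi (fun q => 'J Psi q)).
      exact: C1_lipschitz_near oU Ux (sPhi 1%N).
    exact: C2_lipschitz_near_jacobian oPU (PU _ Ux) (sPsi 2%N).
have nU : nbhs x U by apply: open_nbhs_nbhs.
near=> p; have Up : U p by near: p.
move=> Mp; split=> [w|w [I [g [[oI sg gM] I0 g0 <-{w}]]]].
  (* w *m Q p is the velocity at time 0 of the curve whose image in the chart is
     the line through Phi p directed by a vector of R^d x {0}. *)
  rewrite mulmxA; set a := w *m (_ *m _).
  have at0 : Phi p + 0 *: a = Phi p by rewrite scale0r addr0.
  exists [set t | (Phi @` U) (Phi p + t *: a)], (fun t => Psi (Phi p + t *: a)).
  rewrite /= at0; split=> //; last 1 first.
  - rewrite derive1E -deriveEjacobian; last exact/dPsi/PU.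
    have [|_] := is_derive_comp_affine (Phi p) a Psi 0; rewrite at0 //.
    exact/dPsi/PU.
  - split; first exact: (open_affine_preimage _ (Phi p) a oPU).
      by move=> k; exact: (Ck_on_comp_affine _ _ (Phi p) a Psi (sPsi k)).
    move=> t [z Uz zE]; rewrite -zE PsiK//; apply/flat => // i di.
    rewrite zE [LHS]mxE [X in _ + X]mxE /a mulmxA mulmx_pid_entry.
    rewrite ltnNge di /= mulr0 addr0.
    exact: (flat _ Up).1.
  - exact: PU.
  - exact: PsiK.
have dg : differentiable g 0 by apply: (sg 1%N).1.
have dPg : differentiable Phi (g 0) by rewrite g0; exact: dPhi.
rewrite derive1E; set w := 'D_1 g 0.
(* In the chart a curve of M stays in R^d x {0}, hence so does its velocity:
   dropping the last coordinates has no effect, and Psi inverts Phi. *)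
have wJ : w *m 'J Phi p = 'D_1 (Phi \o g) 0.
  by rewrite (derive_comp _ _ _ _ _ _ _ dg dPg) (deriveEjacobian _ dPg) g0.
have -> : w *m ('J Phi p *m pid_mx d *m 'J Psi (Phi p)) =
    w *m 'J Phi p *m 'J Psi (Phi p).
  rewrite !mulmxA; congr (_ *m _).
  apply/rowP => j; rewrite mulmx_pid_entry; case: ltnP => // dj.
  rewrite wJ -derive_coord; last first.
    exact/diff_derivable/differentiable_comp.
  rewrite (@near_eq_derive _ _ _ _ (cst 0)) ?derive_cst//.
  have nI : nbhs (0 : R) I by apply: open_nbhs_nbhs.
  have nUg : nbhs (0 : R) (g @^-1` U).
    apply: (differentiable_continuous dg); rewrite /= g0.
    by apply: open_nbhs_nbhs.
  apply: filterS2 nI nUg => t It Ut /=.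
  by apply: (flat _ Ut).1 => //; exact: gM.
have dPhip := dPhi p Up; have dPsip := dPsi _ (PU p Up).
rewrite -(deriveEjacobian _ dPhip) -(deriveEjacobian _ dPsip).
rewrite -(derive_comp _ _ _ _ _ _ _ dPhip dPsip).
rewrite (@near_eq_derive _ _ _ _ id) ?derive_id//.
have : nbhs p U by apply: open_nbhs_nbhs.
by apply: filterS => z Uz; exact: PsiK.
Unshelve. all: by end_near. Qed.

End TangentSpaces.

(** * The dot product against the sup norm *)

Section DotProduct.
Context {R : realType} {D : nat}.
Implicit Types (u v w : 'rV[R]_D) (a : R).

Lemma dotE u v : dot u v = (u *m v^T) 0 0.
Proof. by rewrite mxE; apply: eq_bigr => i _; rewrite mxE. Qed.

Lemma dotC u v : dot u v = dot v u.
Proof. by apply: eq_bigr => i _; rewrite mulrC. Qed.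

Lemma dotDl u v w : dot (u + v) w = dot u w + dot v w.
Proof. by rewrite !dotE mulmxDl mxE. Qed.

Lemma dotZl a u v : dot (a *: u) v = a * dot u v.
Proof. by rewrite !dotE -scalemxAl mxE. Qed.

Lemma dotNl u v : dot (- u) v = - dot u v.
Proof. by rewrite !dotE mulNmx mxE. Qed.

Lemma dotBl u v w : dot (u - v) w = dot u w - dot v w.
Proof. by rewrite dotDl dotNl. Qed.

Lemma dotDr u v w : dot w (u + v) = dot w u + dot w v.
Proof. by rewrite dotC dotDl !(dotC w). Qed.

Lemma dotZr a u v : dot v (a *: u) = a * dot v u.
Proof. by rewrite dotC dotZl (dotC v). Qed.

Lemma dotNr u v : dot v (- u) = - dot v u.
Proof. by rewrite dotC dotNl (dotC v). Qed.

Lemma dotBr u v w : dot w (u - v) = dot w u - dot w v.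
Proof. by rewrite dotDr dotNr. Qed.

Lemma dot_self_ge0 u : 0 <= dot u u.
Proof. by apply: sumr_ge0 => i _; rewrite -expr2 sqr_ge0. Qed.

Lemma enorm_sqr u : enorm u ^+ 2 = dot u u.
Proof. by rewrite sqr_sqrtr// dot_self_ge0. Qed.

Lemma norm_dot_le u v : `|dot u v| <= D%:R * (`|u| * `|v|).
Proof.
rewrite (le_trans (ler_norm_sum _ _ _))//.
rewrite mulr_natl -[X in _ *+ X]card_ord -sumr_const ler_sum// => k _.
by rewrite normrM ler_pM// mx_entry_le_norm.
Qed.

Lemma norm_le_enorm u : `|u| <= enorm u.
Proof.
apply: mx_norm_le => [|i j]; first exact: sqrtr_ge0.
rewrite ord1 -(sqrtr_sqr (u 0 j)) ler_wsqrtr// /dot (bigD1 j)//= expr2 lerDl.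
by apply: sumr_ge0 => k _; rewrite -expr2 sqr_ge0.
Qed.

Lemma norm_sqr_le_dot u : `|u| ^+ 2 <= dot u u.
Proof.
by rewrite -enorm_sqr; apply: lerXn2r (norm_le_enorm u);
  rewrite nnegrE ?sqrtr_ge0.
Qed.

(** How a self-improving inequality [<u, u> <= b |u|] is turned into a bound, the
    left side being Euclidean and the right side a sup norm. *)
Lemma norm_le_of_dot u b : 0 <= b -> dot u u <= b * `|u| -> `|u| <= b.
Proof.
move=> b0 ub; have [->|u0] := eqVneq `|u| 0; first by [].
have u_gt0 : 0 < `|u| by rewrite lt_def u0 /=.
by rewrite -(ler_pM2r u_gt0) -expr2 (le_trans (norm_sqr_le_dot u)).
Qed.

Lemma is_derive_dot (f g : R -> 'rV[R]_D) (df dg : 'rV[R]_D) (t : R) :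
  is_derive t 1 f df -> is_derive t 1 g dg ->
  is_derive t 1 (fun t => dot (f t) (g t)) (dot df (g t) + dot (f t) dg).
Proof.
move=> [ff <-] [gg <-]; set df' := 'D_1 f t; set dg' := 'D_1 g t.
have coord (h : R -> 'rV[R]_D) i : derivable h t 1 ->
    is_derive t 1 (fun t => h t 0 i) (('D_1 h t) 0 i).
  move=> hh; apply: DeriveDef; last exact: derive_coord.
  by move/derivable_mxP : hh; apply.
have -> : (fun t => dot (f t) (g t)) =
    \sum_(i < D) ((fun t => f t 0 i) * (fun t => g t 0 i)).
  by apply/funext => u; rewrite fct_sumE.
have -> : dot df' (g t) + dot (f t) dg' =
    \sum_(i < D) (f t 0 i *: dg' 0 i + g t 0 i *: df' 0 i).
  by rewrite -big_split/=; apply: eq_bigr => i _; rewrite addrC (mulrC (df' 0 i)).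
by apply: is_derive_sum => i; apply: is_deriveM; exact: coord.
Qed.

End DotProduct.

(** * Mean value estimates *)

Section CurveEstimates.
Context {R : realType}.

(** It turns the Lipschitz continuity of the projectors into a bound on the
    acceleration of a curve, without differentiating them along the curve. *)
Lemma norm_derive_le_of_lipschitz (f : R -> R) (t l b : R) :
  is_derive t 1 f l -> (\forall u \near t, `|f u - f t| <= b * `|u - t|) ->
  `|l| <= b.
Proof.
move=> [fl <-] /nbhs_ballP[e /= e0 fb]; rewrite leNgt; apply/negP => bl.
have Nq := @cvgr_norm_gt _ _ _ _ _ _ _ fl _ bl.
suff /filter_ex[h []] : \forall h \near (0 : R)^',
    b < `|h^-1 *: ((f \o shift t) (h *: 1) - f t)| /\ `|h| < e /\ h != 0.
  rewrite /= [_%:A]mulr1 normrZ normfV => bh [he h0].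
  have := fb (h + t); rewrite addrK -ball_normE /=.
  have -> : t - (h + t) = - h by ring.
  rewrite normrN => /(_ he).
  by rewrite leNgt -ltr_pdivlMr ?normr_gt0// mulrC bh.
near=> h; split; first by near: h; exact: Nq.
split; first by near: h; exact: dnbhs0_lt.
by near: h; exact: nbhs_dnbhs_neq.
Unshelve. all: by end_near. Qed.

Lemma norm_increment_le m n (f df : R -> 'M[R]_(m, n)) (a c b : R) :
  0 <= b -> a <= c -> (forall t : R, a <= t <= c -> is_derive t 1 f (df t)) ->
  (forall t : R, a <= t <= c -> `|df t| <= b) ->
  `|f c - f a| <= b * (c - a).
Proof.
move=> b0 ac fdf dfb; apply: mx_norm_le => [|i j].
  by rewrite mulr_ge0// subr_ge0.
have fij (t : R) : a <= t <= c ->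
    is_derive t 1 (fun t => f t i j) (df t i j).
  move=> /fdf[ff <-]; apply: DeriveDef; last exact: derive_coord.
  by move/derivable_mxP : ff; apply.
rewrite !mxE; have [t tac ->] := MVT_closed _ _ _ _ ac fij.
rewrite normrM (ger0_norm (_ : 0 <= c - a)) ?subr_ge0//.
rewrite ler_wpM2r ?subr_ge0// (le_trans (mx_entry_le_norm _ _ _ _ _))//.
exact: dfb.
Qed.

Lemma taylor2_le (h h1 h2 : R -> R) (b : R) :
  (forall t : R, 0 <= t <= 1 -> is_derive t 1 h (h1 t)) ->
  (forall t : R, 0 <= t <= 1 -> is_derive t 1 h1 (h2 t)) ->
  (forall t : R, 0 <= t <= 1 -> `|h2 t| <= b) ->
  `|h 1 - h 0 - h1 0| <= b.
Proof.
move=> dh dh1 h2b.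
have [t /andP[t0 t1] ->] := MVT_closed _ _ _ _ ler01 dh.
rewrite subr0 mulr1.
have [u /andP[u0 ut] ->] : exists2 u, 0 <= u <= t & h1 t - h1 0 = h2 u * (t - 0).
  apply: MVT_closed => // u /andP[u0 ut].
  by apply: dh1; rewrite u0 (le_trans ut).
have hu : `|h2 u| <= b by rewrite h2b// u0 (le_trans ut).
rewrite subr0 normrM (ger0_norm t0) (le_trans _ hu)//.
by rewrite ler_piMr.
Qed.

End CurveEstimates.

(** * Expansion of geodesics *)

Section Geodesics.
Context {R : realType} {D : nat}.
Implicit Types (M : set 'rV[R]_D) (I : set R) (g : R -> 'rV[R]_D).

Lemma smooth_curve_derive {M I g} {t : R} : smooth_curve M I g -> I t ->
  is_derive t 1 g (g^`()%classic t) /\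
  is_derive t 1 g^`()%classic (g^`(2)%classic t).
Proof.
move=> [_ sg _] It.
have derivableE (f : R -> 'rV[R]_D) : differentiable f t ->
    is_derive t 1 f (f^`()%classic t).
  by move=> df; rewrite derive1E; apply/derivableP/derivable1_diffP.
split; first by apply: derivableE; exact: (sg 1%N).1.
rewrite derive1nS; apply: derivableE.
have -> : g^`()%classic = 'D_1 g by apply/funext => u; rewrite derive1E.
exact: ((sg 2%N).2 1).1.
Qed.

(** The derivative of [<g', g'>] is [2 <g'', g'>], which vanishes since [g'] is
    tangent. *)
Lemma geodesic_speed {M I g} {t : R} : geodesic M I g -> I 0 -> I t ->
  enorm (g^`()%classic t) = enorm (g^`()%classic 0).
Proof.
move=> [II cg og] I0 It; congr Num.sqrt.
pose sp (u : R) := dot (g^`()%classic u) (g^`()%classic u).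
have dsp (u : R) : I u -> is_derive u 1 sp 0.
  move=> Iu; have [_ d2] := smooth_curve_derive cg Iu.
  have := is_derive_dot _ _ _ _ _ d2 d2; rewrite (dotC (g^`()%classic u)).
  by rewrite (og u Iu _ (velocity_tangent _ _ _ _ cg Iu)) addr0.
apply/eqP; rewrite -subr_eq0; apply/eqP.
have [t0|/ltW t0] := leP 0 t.
  have [|u _ ->] := MVT_closed sp (fun=> 0) 0 t t0; last by rewrite mul0r.
  by move=> u ut; apply: dsp; exact: II ut.
apply: oppr_inj; rewrite opprB oppr0.
have [|u _ ->] := MVT_closed sp (fun=> 0) t 0 t0; last by rewrite mul0r.
by move=> u ut; apply: dsp; exact: II ut.
Qed.

(** The speed is constant and dominates the sup norm of the velocity. *)
Lemma geodesic_lipschitz {M I g} {a b : R} : geodesic M I g -> I 0 ->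
  I a -> I b -> `|g b - g a| <= enorm (g^`()%classic 0) * `|b - a|.
Proof.
move=> gg I0; have [II cg _] := gg.
wlog ab : a b / a <= b => [wh Ia Ib|Ia Ib].
  have [ab|/ltW ba] := leP a b; first exact: wh.
  by rewrite distrC (distrC b); exact: wh.
rewrite (ger0_norm (_ : 0 <= b - a)) ?subr_ge0//.
apply: (norm_increment_le _ _ _ g^`()%classic) => //; first exact: sqrtr_ge0.
  move=> t tab; apply: (smooth_curve_derive cg _).1; exact: II tab.
move=> t tab; rewrite (le_trans (norm_le_enorm _))//.
by rewrite (geodesic_speed gg I0)//; exact: II tab.
Qed.

(** The error of the first order expansion of [g 1] is [O(s^2)] in all directions
    and [O(s^3)] in the tangent ones, with [s] the speed, and [C] and [e] depend
    on [M] and [x] only: this is the uniformity in the direction of the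
    geodesic.

    With [N = g'' t] and [u] close to [t], the vector [g' u] is fixed by
    [Q (g u)], while [N] is orthogonal to the range of [Q (g t)], so
    [<N, g' u - g' t> = <N, g' u (Q (g u) - Q (g t))>] has size at most
    [|N| s K s |u - t|].  Letting [u] tend to [t] gives [<N, N> = O(|N| s^2)].
    In the same way, for [u] tangent at [x],
    [<N, u> = <N, u (Q x - Q (g t))> = O(s^2 |u| s)]. *)
Lemma geodesic_expansion d M x : embedded_submanifold d M -> M x ->
  exists2 C : R, 0 <= C & exists2 e : R, 0 < e &
    forall I g, geodesic M I g -> I 0 -> I 1 -> g 0 = x ->
      enorm (g^`()%classic 0) < e ->
      (forall u, `|dot (g 1 - x - g^`()%classic 0) u| <=
         C * enorm (g^`()%classic 0) ^+ 2 * `|u|) /\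
      (forall u, tangent_space M x u -> `|dot (g 1 - x - g^`()%classic 0) u| <=
         C * enorm (g^`()%classic 0) ^+ 3 * `|u|).
Proof.
move=> hM Mx; have [Q [K K0 [A nA QA]] nQ] := tangent_projector _ _ _ hM Mx.
have [e /= e0 eAQ] : exists2 e : R, 0 < e & ball x e `<=` A `&`
    [set p | M p -> (forall w, tangent_space M p (w *m Q p)) /\
                    (forall w, tangent_space M p w -> w *m Q p = w)].
  by apply/nbhs_ballP; exact: filterI.
pose B : R := D%:R * (D%:R * K).
have B0 : 0 <= B by rewrite !mulr_ge0.
pose C : R := D%:R * B + D%:R * (B * (D%:R * K)).
have C0 : 0 <= C by rewrite addr_ge0// !mulr_ge0.
exists C => //; exists e => // I g gg I0 I1 g0 ge.
set s := enorm _ in ge *; have s0 : 0 <= s by exact: sqrtr_ge0.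
have [II cg og] := gg.
have It (t : R) : 0 <= t <= 1 -> I t by exact: II.
(* The geodesic stays where the projectors are under control. *)
have gx (t : R) : 0 <= t <= 1 -> `|g t - x| <= s.
  move=> t01; rewrite -g0 (le_trans (geodesic_lipschitz gg I0 I0 (It _ t01)))//.
  by case/andP: t01 => t0 t1; rewrite subr0 ger0_norm// ler_piMr.
have near_x (t : R) : 0 <= t <= 1 -> ball x e (g t).
  by move=> t01; rewrite -ball_normE /= distrC (le_lt_trans (gx _ t01)).
have Mg (t : R) : I t -> M (g t) by case: cg => _ _; apply.
have accel (t : R) : 0 <= t <= 1 -> `|g^`(2)%classic t| <= B * s ^+ 2.
  move=> t01; have [_ d2] := smooth_curve_derive cg (It _ t01).
  apply: norm_le_of_dot; first by rewrite mulr_ge0 ?exprn_ge0.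
  set N := g^`(2)%classic t; rewrite -[dot N N]ger0_norm ?dot_self_ge0//.
  apply: (norm_derive_le_of_lipschitz (fun u => dot (g^`()%classic u) N) t).
    have := is_derive_dot _ (fun=> N) _ 0 _ d2 (is_derive_cst _ _ _).
    by rewrite -/N (_ : dot _ 0 = 0) ?addr0// -(scale0r 0) dotZr mul0r.
  have ng : nbhs (g t) (ball x e).
    by apply: open_nbhs_nbhs; split; [exact: ball_open|exact: near_x].
  have [[dg _] _] := smooth_curve_derive cg (It _ t01).
  have ct : {for t, continuous g}.
    exact/differentiable_continuous/derivable1_diffP.
  have nI : nbhs t I by apply: open_nbhs_nbhs; case: cg; split => //; exact: It.
  apply: filterS2 nI (ct _ ng) => u Iu gu /=.
  have [Ay Qy] := eAQ _ (near_x _ t01); have [Az Qz] := eAQ _ gu.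
  have [Qt Qtid] := Qy (Mg _ (It _ t01)); have [_ Qu] := Qz (Mg _ Iu).
  have -> : dot (g^`()%classic u) N - dot (g^`()%classic t) N =
      dot N (g^`()%classic u *m (Q (g u) - Q (g t))).
    rewrite mulmxBr (Qu _ (velocity_tangent _ _ _ _ cg Iu)).
    rewrite -dotBl dotC.
    rewrite !dotBr (og t (It _ t01) _ (velocity_tangent _ _ _ _ cg (It _ t01))).
    by rewrite (og t (It _ t01) _ (Qt _)).
  rewrite (le_trans (norm_dot_le _ _))//.
  have : `|g^`()%classic u *m (Q (g u) - Q (g t))| <=
      D%:R * (s * (K * (s * `|u - t|))).
    rewrite (le_trans (ler_norm_mulmx _ _ _ _ _))// ler_wpM2l// ler_pM//.
      by rewrite (le_trans (norm_le_enorm _))// (geodesic_speed gg I0).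
    rewrite (le_trans (QA _ _ Az Ay))// ler_wpM2l//.
    exact: (geodesic_lipschitz gg I0 (It _ t01) Iu).
  move=> h.
  apply: (@le_trans _ _
    (D%:R * (`|N| * (D%:R * (s * (K * (s * `|u - t|))))))).
    by apply: ler_wpM2l => //; exact: ler_wpM2l.
  by rewrite le_eqVlt; apply/orP; left; apply/eqP; rewrite /B; ring.
have expand b (u : 'rV[R]_D) :
    (forall t : R, 0 <= t <= 1 -> `|dot (g^`(2)%classic t) u| <= b) ->
    `|dot (g 1 - x - g^`()%classic 0) u| <= b.
  move=> ub; rewrite !dotBl -g0.
  apply: (taylor2_le (fun t => dot (g t) u) (fun t => dot (g^`()%classic t) u)
                     (fun t => dot (g^`(2)%classic t) u)) => // t t01;
    have [d1 d2] := smooth_curve_derive cg (It _ t01).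
  - have := is_derive_dot _ (fun=> u) _ 0 _ d1 (is_derive_cst _ _ _).
    by rewrite (_ : dot _ 0 = 0) ?addr0// -(scale0r 0) dotZr mul0r.
  - have := is_derive_dot _ (fun=> u) _ 0 _ d2 (is_derive_cst _ _ _).
    by rewrite (_ : dot _ 0 = 0) ?addr0// -(scale0r 0) dotZr mul0r.
split=> [u|u Tu]; apply: expand => t t01.
  apply: (@le_trans _ _ (D%:R * (B * s ^+ 2 * `|u|))).
    by rewrite (le_trans (norm_dot_le _ _))// ler_wpM2l// ler_wpM2r// accel.
  have -> : D%:R * (B * s ^+ 2 * `|u|) = D%:R * B * s ^+ 2 * `|u| by ring.
  rewrite ler_wpM2r// ler_wpM2r ?exprn_ge0//.
  by rewrite /C lerDl !mulr_ge0.
have [Ax Qx] := eAQ _ (ballxx x e0); have [At Qt] := eAQ _ (near_x _ t01).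
have [_ Qxid] := Qx Mx; have [QtT _] := Qt (Mg _ (It _ t01)).
have -> : dot (g^`(2)%classic t) u =
    dot (g^`(2)%classic t) (u *m (Q x - Q (g t))).
  by rewrite mulmxBr (Qxid _ Tu) dotBr (og t (It _ t01) _ (QtT _)) subr0.
rewrite (le_trans (norm_dot_le _ _))//.
apply: (@le_trans _ _ (D%:R * (B * s ^+ 2 * (D%:R * (`|u| * (K * s)))))).
  rewrite ler_wpM2l// ler_pM//; first exact: accel.
  rewrite (le_trans (ler_norm_mulmx _ _ _ _ _))// ler_wpM2l// ler_wpM2l//.
  by rewrite (le_trans (QA _ _ Ax At))// ler_wpM2l// distrC gx.
apply: (@le_trans _ _ (D%:R * (B * (D%:R * K)) * s ^+ 3 * `|u|)).
  by rewrite le_eqVlt; apply/orP; left; apply/eqP; ring.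
rewrite ler_wpM2r// ler_wpM2r ?exprn_ge0//.
by rewrite /C lerDr !mulr_ge0.
Qed.

End Geodesics.

(** * Orthogonal projection and the spherical distance *)

Section OrthogonalProjection.
Context {R : realType} {D : nat}.
Implicit Types (V : set 'rV[R]_D) (w p q c n : 'rV[R]_D).

(** The diagonal of [A^T A] holds the squared norms of the columns of [A]. *)
Lemma mul_trmx_eq0 m k (A : 'M[R]_(m, k)) : A^T *m A = 0 -> A = 0.
Proof.
move=> A0; apply/matrixP => i j; rewrite mxE.
have /eqP : (A^T *m A) j j = 0 by rewrite A0 mxE.
rewrite mxE.
under eq_bigr do rewrite mxE -expr2.
rewrite psumr_eq0 => [/allP/(_ i (mem_index_enum i))|l _]; last exact: sqr_ge0.
by rewrite /= sqrf_eq0 => /eqP.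
Qed.

(** The normal equations [w A^T = q A A^T] are solvable: if [A A^T X = 0] then
    [(A^T X)^T (A^T X) = 0], hence [A^T X = 0], so [A^T] and [A A^T] have the same
    row space. *)
Lemma orthogonal_decomposition (A : 'M[R]_D) w :
  exists q, forall u, dot (w - q *m A) (u *m A) = 0.
Proof.
have /submxP[q wq] : (w *m A^T <= A *m A^T)%MS.
  apply: submx_trans (submxMl _ _) _; rewrite submxE.
  apply/eqP/mul_trmx_eq0.
  by rewrite trmx_mul trmxK -mulmxA (mulmxA A) mulmx_coker mulmx0.
exists q => u; rewrite dotE trmx_mul mulmxA mulmxBl -(mulmxA q) -wq subrr.
by rewrite mul0mx mxE.
Qed.

Lemma orth_projE V w p : (forall u v, V u -> V v -> V (u - v)) ->
  V p -> orthogonal_to V (w - p) -> orth_proj V w = p.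
Proof.
move=> VB Vp wp; apply: xget_subset1 => // a b [Va wa] [Vb wb].
have abE : a - b = (w - b) - (w - a) by apply/rowP => i; rewrite !mxE; ring.
have dab : dot (a - b) (a - b) = 0.
  by rewrite {1}abE dotBl wb ?wa ?subrr//; exact: VB.
apply/eqP; rewrite -subr_eq0 -normr_eq0 -sqrf_eq0 eq_le sqr_ge0 andbT.
by rewrite -dab norm_sqr_le_dot.
Qed.

(** The projection of [z - c] on [V] is [q - b n] with [b = r - <z - x, n>], and
    that of [x - c] is [- r n].  Hence [x] is its own image on the sphere and the
    cosine of the angle is [b / |q - b n|]. *)
Lemma sphere_distE V c n x q z (r : R) :
  (forall u v, V u -> V v -> V (u - v)) -> V q -> (forall a : R, V (a *: n)) ->
  0 < r -> enorm n = 1 -> c = x + r *: n -> dot q n = 0 ->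
  (forall u, V u -> dot (z - x - q - dot (z - x) n *: n) u = 0) ->
  0 < r - dot (z - x) n ->
  sphere_dist V c r x z = r * acos ((r - dot (z - x) n) /
    Num.sqrt (dot q q + (r - dot (z - x) n) ^+ 2)).
Proof.
move=> VB Vq Vn r0 n1 -> qn zq b0; set b := r - _.
have nn : dot n n = 1 by rewrite -enorm_sqr n1 expr1n.
have r_neq0 : r != 0 by rewrite gt_eqF.
have Px : orth_proj V (x - (x + r *: n)) = - r *: n.
  have -> : x - (x + r *: n) = - r *: n.
    by rewrite opprD addrA subrr add0r scaleNr.
  by apply: orth_projE => // u _; rewrite subrr -(scale0r 0) dotZl mul0r.
have Pz : orth_proj V (z - (x + r *: n)) = q - b *: n.
  apply: orth_projE => //; first exact: VB.
  move=> u /zq <-; congr (dot _ u); rewrite /b.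
  by apply/rowP => i; rewrite !mxE; ring.
have enx : enorm (- r *: n) = r.
  by rewrite /enorm dotZl dotZr nn mulr1 mulrNN -expr2 sqrtr_sqr gtr0_norm.
have PP : dot (q - b *: n) (q - b *: n) = dot q q + b ^+ 2.
  by rewrite !dotBl !dotBr !dotZl !dotZr nn (dotC n) qn; ring.
rewrite /sphere_dist /sphere_proj Px Pz enx divff// scale1r.
have cancel u w : u + w - u = w by rewrite addrAC subrr add0r.
rewrite !cancel.
congr (r * acos _).
rewrite !dotZl !dotZr dotBr dotZr dotC qn nn /enorm PP.
by field; rewrite r_neq0 gt_eqF// sqrtr_gt0 ltr_wpDl ?dot_self_ge0// exprn_gt0.
Qed.

End OrthogonalProjection.

(** * From the angle to the arc length *)

Section Trigonometry.
Context {R : realType}.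

(** The angle of a right triangle with legs [a] and [b], from its cosine. *)
Lemma acos_adjacent (a b : R) : 0 <= a -> 0 < b ->
  acos (b / Num.sqrt (a ^+ 2 + b ^+ 2)) = atan (a / b).
Proof.
move=> a0 b0; have t0 : 0 <= a / b by rewrite divr_ge0// ltW.
have -> : b / Num.sqrt (a ^+ 2 + b ^+ 2) = cos (atan (a / b)).
  have -> : a ^+ 2 + b ^+ 2 = b ^+ 2 * (1 + (a / b) ^+ 2).
    by field; rewrite gt_eqF.
  rewrite cos_atan sqrtrM ?sqr_ge0// sqrtr_sqr gtr0_norm// invfM mulrA.
  by rewrite divff ?mul1r// gt_eqF.
rewrite cosK// in_itv /= -atan0 le_atan//= ltW// (lt_trans (atan_ltpi2 _))//.
by rewrite ltr_pdivrMr// ltr_pMr ?pi_gt0// ltr1n.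
Qed.

(** The derivative of [atan t - t] lies between [- t^2] and 0. *)
Lemma atan_sub_le (t : R) : 0 <= t -> `|atan t - t| <= t ^+ 3.
Proof.
move=> t0; have [u /andP[u0 ut] E] :
    exists2 u, 0 <= u <= t & (atan t - t) - (atan 0 - 0) =
      ((1 + u ^+ 2)^-1 - 1) * (t - 0).
  by apply: (MVT_closed (fun t => atan t - t)) => //.
move: E; rewrite atan0 !subr0 => ->.
have u1 : 0 < 1 + u ^+ 2 by rewrite ltr_pwDl// sqr_ge0.
rewrite [leRHS]exprSr normrM (ger0_norm t0) ler_wpM2r//.
have -> : (1 + u ^+ 2)^-1 - 1 = - (u ^+ 2 / (1 + u ^+ 2)).
  by field; rewrite gt_eqF.
have q0 : 0 <= u ^+ 2 / (1 + u ^+ 2) by rewrite divr_ge0 ?sqr_ge0// ltW.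
rewrite normrN (ger0_norm q0).
have ut2 : u ^+ 2 <= t ^+ 2 by rewrite lerXn2r ?nnegrE.
rewrite (le_trans _ ut2)// ler_pdivrMr//.
by rewrite ler_peMr ?sqr_ge0// lerDl sqr_ge0.
Qed.

(** Both [a = s + O(s^3)] and [b = r + O(s^2)] are needed at this precision: they
    enter [r a / b] as [r (a - s) + s (r - b)], where the deviation of [b] is
    multiplied by [s]. *)
Lemma arc_length_estimate (r C0 : R) : 0 < r -> 0 <= C0 ->
  exists C : R, \forall s \near 0^'+, forall a b : R, 0 <= a ->
    `|a ^+ 2 - s ^+ 2| <= C0 * s ^+ 4 -> `|b - r| <= C0 * s ^+ 2 ->
    0 < b /\ `|r * atan (a / b) - s| <= C * s ^+ 3.
Proof.
move=> r0 C00.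
exists (64 / r ^+ 2 + 2 * (r + 1) * C0 / r).
have C1 : 0 < C0 + 1 by rewrite ltr_wpDl.
near=> s => a b a0 ha hb.
have s0 : 0 < s by [].
have s1 : s <= 1 by near: s; exact: nbhs_right_le.
have sC1 : s * (C0 + 1) <= 1.
  by rewrite -ler_pdivlMr//; near: s; apply: nbhs_right_le; rewrite divr_gt0.
have sCr : s * (C0 + 1) <= r / 2.
  by rewrite -ler_pdivlMr//; near: s; apply: nbhs_right_le; rewrite !divr_gt0.
have s2 : C0 * s ^+ 2 <= s * (C0 + 1).
  rewrite expr2 mulrA [leRHS]mulrC ler_wpM2r ?(ltW s0)//.
  by rewrite (le_trans (ler_piMr _ s1))// lerDl.
have b_ge : r / 2 <= b.
  move: hb; rewrite ler_norml => /andP[hb _]; lra.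
have b0 : 0 < b by rewrite (lt_le_trans _ b_ge)// divr_gt0.
(* a^2 - s^2 is divisible by a + s, which is at least s. *)
have a_s : `|a - s| <= C0 * s ^+ 3.
  rewrite -(ler_pM2r s0) -mulrA -exprSr (le_trans _ ha)//.
  rewrite subr_sqr normrM ler_wpM2l// ger0_norm ?addr_ge0 ?(ltW s0)//.
  by rewrite lerDr.
have a2s : a <= 2 * s.
  have : C0 * s ^+ 3 <= s.
    rewrite exprSr mulrA ler_piMl ?(ltW s0)//.
    exact: le_trans s2 sC1.
  move: a_s; rewrite ler_norml => /andP[_]; lra.
split=> //.
have -> : r * atan (a / b) - s = r * (atan (a / b) - a / b) +
    (r * (a - s) + s * (r - b)) / b.
  by field; rewrite gt_eqF.
have bV : b^-1 <= 2 / r.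
  by rewrite -[2 / r]invrK invf_div lef_pV2 ?posrE ?divr_gt0.
have t0 : 0 <= a / b by rewrite divr_ge0// ltW.
have t_le : a / b <= 4 / r * s.
  have -> : 4 / r * s = (2 * s) * (2 / r) by ring.
  by rewrite ler_pM// invr_ge0 ltW.
rewrite (le_trans (ler_normD _ _))// [leRHS]mulrDl lerD//.
  rewrite normrM (gtr0_norm r0).
  have -> : 64 / r ^+ 2 * s ^+ 3 = r * (4 / r * s) ^+ 3.
    by field; rewrite gt_eqF.
  rewrite ler_wpM2l ?(ltW r0)// (le_trans (atan_sub_le _ t0))//.
  by rewrite lerXn2r ?nnegrE ?(le_trans t0).
have -> : 2 * (r + 1) * C0 / r * s ^+ 3 =
    (r * (C0 * s ^+ 3) + s * (C0 * s ^+ 2)) * (2 / r) by ring.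
rewrite normrM (ger0_norm (_ : 0 <= b^-1)) ?invr_ge0 ?(ltW b0)//.
have num : `|r * (a - s) + s * (r - b)| <= r * (C0 * s ^+ 3) + s * (C0 * s ^+ 2).
  rewrite (le_trans (ler_normD _ _))// !normrM (gtr0_norm r0) (gtr0_norm s0).
  by rewrite (distrC r); apply: lerD; apply: ler_wpM2l => //; exact: ltW.
by apply: ler_pM => //; rewrite invr_ge0 ltW.
Unshelve. all: by end_near. Qed.

End Trigonometry.

(** * Comparison of the two distances *)

Lemma tangent_space_range (R : realType) (D d : nat) (M : set 'rV[R]_D) x :
  embedded_submanifold d M -> M x ->
  exists A : 'M[R]_D, forall u, tangent_space M x u <-> exists w, u = w *m A.
Proof.
move=> hM Mx; have [Q _ nQ] := tangent_projector _ _ _ hM Mx.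
have [QT TQ] := nbhs_singleton nQ Mx.
exists (Q x) => u; split=> [Tu|[w ->]]; last exact: QT.
by exists u; rewrite TQ.
Qed.

Lemma geodesic_dist_self (R : realType) (D : nat) (M : set 'rV[R]_D) x :
  M x -> (geodesic_dist M x x <= 0)%E.
Proof. by move=> Mx; apply: ereal_inf_lbound; exact: path_nil. Qed.

(** Without such a geodesic the exponential map would return [x], and the
    distance from [x] to itself is not positive. *)
Lemma exp_map_geodesic (R : realType) (D : nat) (M : set 'rV[R]_D) x w (s : R) :
  M x -> 0 < s -> geodesic_dist M x (exp_map M x w) = s%:E ->
  exists (I : set R) (g : R -> 'rV[R]_D),
    [/\ geodesic M I g, I 0 & I 1] /\
    [/\ g 0 = x, g^`()%classic 0 = w & g 1 = exp_map M x w].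
Proof.
move=> Mx s0; rewrite /exp_map; case: xgetP => [y yE [I [g [gI g1]]] _|noG].
  by exists I, g.
move=> xs; have := geodesic_dist_self _ _ _ _ Mx.
by rewrite xs lee_fin leNgt s0.
Qed.

Theorem theorem4 (R : realType) (d D : nat) (hdD : (d < D)%N)
    (M : set 'rV[R]_D) (hM : embedded_submanifold d M) (hcpt : compact M)
    (x : 'rV[R]_D) (hx : M x)
    (r : R) (hr : 0 < r)
    (n : 'rV[R]_D) (hn : enorm n = 1)
    (hnormal : orthogonal_to (tangent_space M x) n)
    (c : 'rV[R]_D) (hc : c = x + r *: n) :
  exists C : R, \forall s \near 0^'+,
    forall v y : 'rV[R]_D,
      tangent_space M x v -> enorm v = 1 ->
      y = exp_map M x (s *: v) ->
      geodesic_dist M x y = s%:E ->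
      `|sphere_dist (tangent_plus_line M x n) c r x y - s| <= C * s ^+ 3.
Proof.
have [A TA] := tangent_space_range _ _ _ _ _ hM hx.
have [K K0 [e e0 expand]] := geodesic_expansion _ _ _ hM hx.
pose C0 : R := D%:R * K ^+ 2 + 2 * (D%:R * K) + K.
have C00 : 0 <= C0 by rewrite !addr_ge0 ?mulr_ge0 ?exprn_ge0.
have [C estimate] := arc_length_estimate r C0 hr C00.
exists C; near=> s => v y Tv v1 yE dist_y.
have s0 : 0 < s by [].
have s1 : s <= 1 by near: s; exact: nbhs_right_le.
have est : forall a b : R, 0 <= a -> `|a ^+ 2 - s ^+ 2| <= C0 * s ^+ 4 ->
    `|b - r| <= C0 * s ^+ 2 -> 0 < b /\ `|r * atan (a / b) - s| <= C * s ^+ 3.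
  by near: s; exact: estimate.
rewrite yE in dist_y.
have [I [g [[gI I0 I1] [g0 dg0 g1]]]] :=
  exp_map_geodesic _ _ _ _ _ _ hx s0 dist_y.
rewrite -yE in g1; have vv : dot v v = 1 by rewrite -enorm_sqr v1 expr1n.
have speed : enorm (g^`()%classic 0) = s.
  by rewrite dg0 /enorm dotZl dotZr vv mulr1 -expr2 sqrtr_sqr gtr0_norm.
have [|normal tangential] := expand I g gI I0 I1 g0.
  by rewrite speed; near: s; exact: nbhs_right_lt.
rewrite speed dg0 g1 in normal tangential.
set del := y - x in normal tangential.
have [k qk] := orthogonal_decomposition A del; set q := k *m A in qk.
have Tq : tangent_space M x q by apply/TA; exists k.
have q_orth u : tangent_space M x u -> dot (del - q) u = 0.
  by move=> /TA[w ->].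
have TB u w : tangent_space M x u -> tangent_space M x w ->
    tangent_space M x (u - w).
  by move=> /TA[a ->] /TA[b ->]; apply/TA; exists (a - b); rewrite mulmxBl.
have TZ (a : R) u : tangent_space M x u -> tangent_space M x (a *: u).
  by move=> /TA[w ->]; apply/TA; exists (a *: w); rewrite scalemxAl.
have T0 : tangent_space M x 0 by apply/TA; exists 0; rewrite mul0mx.
have Tn u : tangent_space M x u -> dot u n = 0.
  by move=> Tu; rewrite dotC hnormal.
have nn : dot n n = 1 by rewrite -enorm_sqr hn expr1n.
set w := q - s *: v.
have Tw : tangent_space M x w by apply: TB => //; exact: TZ.
(* Since w is itself tangent, it can be used as the test direction. *)
have w_le : `|w| <= K * s ^+ 3.
  apply: norm_le_of_dot; first by rewrite mulr_ge0 ?exprn_ge0 ?(ltW s0).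
  rewrite (le_trans _ (tangential w Tw))// (le_trans _ (ler_norm _))//.
  have -> : dot (del - s *: v) w = dot (del - q) w + dot w w.
    by rewrite -dotDl /w addrA subrK.
  by rewrite q_orth// add0r.
(* s <= 1 absorbs the term of order s ^+ 6 that comes from dot w w. *)
have sq : `|enorm q ^+ 2 - s ^+ 2| <= C0 * s ^+ 4.
  have -> : enorm q ^+ 2 - s ^+ 2 = dot w w + 2 * s * dot w v.
    have expandE u : dot (u + s *: v) (u + s *: v) - s ^+ 2 =
        dot u u + 2 * s * dot u v.
      by rewrite !dotDl !dotDr !dotZl !dotZr vv (dotC v); ring.
    by rewrite enorm_sqr -expandE subrK.
  have v_le : `|v| <= 1 by rewrite (le_trans (norm_le_enorm _)) ?v1.
  have Ks0 : 0 <= K * s ^+ 3 by rewrite mulr_ge0 ?exprn_ge0 ?(ltW s0).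
  have ww : `|dot w w| <= D%:R * K ^+ 2 * s ^+ 4.
    rewrite (le_trans (norm_dot_le _ _))// -mulrA ler_wpM2l//.
    rewrite (le_trans (ler_pM _ _ w_le w_le))// -expr2 exprMn -exprM.
    by rewrite ler_wpM2l ?sqr_ge0// ler_wiXn2l// ltW.
  have wv : `|2 * s * dot w v| <= 2 * (D%:R * K) * s ^+ 4.
    rewrite !normrM (gtr0_norm s0) ger0_norm//.
    have -> : 2 * (D%:R * K) * s ^+ 4 = 2 * s * (D%:R * (K * s ^+ 3 * 1)) by ring.
    rewrite ler_wpM2l ?mulr_ge0 ?(ltW s0)// (le_trans (norm_dot_le _ _))//.
    by rewrite ler_wpM2l// ler_pM.
  rewrite (le_trans (ler_normD _ _))// (le_trans (lerD ww wv))//.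
  by rewrite -mulrDl ler_wpM2r ?exprn_ge0 ?(ltW s0)// lerDl.
pose b : R := r - dot del n.
have br : `|b - r| <= C0 * s ^+ 2.
  have -> : b - r = - dot (del - s *: v) n.
    by rewrite dotBl dotZl (Tn _ Tv) /b; ring.
  rewrite normrN (le_trans (normal n))//.
  rewrite (le_trans (_ : _ <= K * s ^+ 2 * 1))//.
    apply: ler_wpM2l; first by rewrite mulr_ge0 ?exprn_ge0 ?(ltW s0).
    by rewrite (le_trans (norm_le_enorm _)) ?hn.
  rewrite mulr1 ler_wpM2r ?exprn_ge0 ?(ltW s0)// lerDr.
  by rewrite addr_ge0 ?mulr_ge0 ?exprn_ge0.
have [b0 arc] := est (enorm q) b (sqrtr_ge0 _) sq br.
rewrite (sphere_distE _ c n x q)//.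
- by rewrite -/del -/b -enorm_sqr acos_adjacent ?sqrtr_ge0.
- move=> _ _ [u1 [a1 [Tu1 ->]]] [u2 [a2 [Tu2 ->]]].
  exists (u1 - u2), (a1 - a2); split; first exact: TB.
  by apply/rowP => i; rewrite !mxE; ring.
- by exists q, 0; rewrite scale0r addr0.
- by move=> a; exists 0, a; rewrite add0r.
- exact: Tn.
move=> _ [u [a [Tu ->]]]; rewrite -/del dotDr dotZr !(dotBl (del - q)) q_orth//.
by rewrite (dotBl del) !dotZl hnormal// nn (Tn _ Tq); ring.
Unshelve. all: by end_near. Qed.
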